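(* There is a randomized algorithm which, given a parameter $k$ and query access to a monotone function $f:\{0,1\}^n\to\{0,1\}$ with $C(f)\le k$, makes $O(k^7\log n)$ queries to $f$ and with high probability returns a certificate of size $O(k^3)$, i.e. a set $S\subseteq[n]$ together with an assignment $\alpha\in\{0,1\}^S$ such that $f(y)$ is the same for all $y$ with $y_S=\alpha$.
   Context: A set $S\subseteq[n]$ is a certificate for $f$'s value on $x$ if $f(y)=f(x)$ for all $y$ agreeing with $x$ on $S$; $C(f)$ is the maximum over $x$ of the minimum size of such a certificate. $f$ is monotone if $x\le y$ coordinatewise implies $f(x)\le f(y)$. ''With high probability'' means with probability at least $1-1/\mathrm{poly}(n)$. *)

(* Defs.v *)
From HB Require Import structures.
From mathcomp Require Import all_boot all_order all_algebra.
From mathcomp Require Import reals.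

Set Implicit Arguments.
Unset Strict Implicit.
Unset Printing Implicit Defensive.

Import Order.TTheory GRing.Theory Num.Theory.

Definition cube (n : nat) := {ffun 'I_n -> bool}.

(* On bool, [==>] is the order false <= true. *)
Definition monotone_fun (n : nat) (f : cube n -> bool) : Prop :=
  forall x y : cube n, (forall i, x i ==> y i) -> f x ==> f y.

Definition agree_on (n : nat) (S : {set 'I_n}) (x y : cube n) : bool :=
  [forall i in S, x i == y i].

Definition certifies (n : nat) (f : cube n -> bool) (x : cube n)
    (S : {set 'I_n}) : bool :=
  [forall y : cube n, agree_on S x y ==> (f y == f x)].

(* The whole set [n] is always a certificate, so the arg min is a genuine
   minimum. *)
Definition certificate_complexity_at (n : nat) (f : cube n -> bool)
    (x : cube n) : nat :=
  #|[arg min_(S < [set: 'I_n] | certifies f x S) #|S| ]|.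

Definition certificate_complexity (n : nat) (f : cube n -> bool) : nat :=
  \max_(x : cube n) certificate_complexity_at f x.

(* A set S together with an assignment in {0,1}^S. *)
Definition partial_assignment (n : nat) : Type :=
  {S : {set 'I_n} & {ffun {i : 'I_n | i \in S} -> bool}}.

Definition restrict (n : nat) (S : {set 'I_n}) (y : cube n) :
    {ffun {i : 'I_n | i \in S} -> bool} :=
  [ffun i => y (val i)].

Definition is_certificate (n : nat) (f : cube n -> bool)
    (c : partial_assignment n) : bool :=
  [forall y : cube n, forall z : cube n,
    (restrict (tag c) y == tagged c) ==> (restrict (tag c) z == tagged c) ==>
    (f y == f z)].

(* Adaptive randomized query procedures (randomized decision trees) over
   {0,1}^n: stop with an output, query the oracle at a point and branch on the
   answer, or draw a fresh uniform element of {0, ..., m} and branch on it. *)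
Inductive query_alg (n : nat) (A : Type) : Type :=
| Return of A
| Query of cube n & (bool -> query_alg n A)
| Draw (m : nat) of ('I_m.+1 -> query_alg n A).

(* Number of queries to f, in the worst case over the random draws. *)
Fixpoint num_queries (n : nat) (A : Type) (f : cube n -> bool)
    (t : query_alg n A) : nat :=
  match t with
  | Return _ => 0
  | Query x b => (num_queries f (b (f x))).+1
  | Draw m b => \max_(i < m.+1) num_queries f (b i)
  end.

(* Probability, over the draws, that the output of t run with oracle f
   satisfies E. *)
Fixpoint output_prob (R : realType) (n : nat) (A : Type) (f : cube n -> bool)
    (E : pred A) (t : query_alg n A) : R :=
  match t with
  | Return a => ((E a : nat)%:R)%R
  | Query x b => output_prob R f E (b (f x))
  | Draw m b => ((\sum_(i < m.+1) output_prob R f E (b i)) / m.+1%:R)%R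
  end.

(* Main.v *)
(** A minimal set [T] with [f (indicator T) = true] has size at most [C(f)], and
    fixing its coordinates to 1 certifies the value 1. Such a set is found
    deterministically with [O(k log n)] queries. Maintain a set [T] and a prefix
    [0, p) such that [f] is true on [T ∪ [0, p)] but false as soon as an element
    of [T] is removed; binary search gives the least [q] with [f] true on
    [T ∪ [0, q)], and if [q > 0] then [q - 1] joins [T] and [p] becomes [q - 1].
    Any certificate of size at most [k] for the indicator of [T ∪ [0, p)] contains
    [T], so this stops after at most [k] additions. *)
Require Import Defs.
From mathcomp Require Import all_boot all_order all_algebra.
From mathcomp Require Import reals exp.
From mathcomp Require Import zify.
Import Order.TTheory GRing.Theory Num.Theory.
Local Open Scope ring_scope.

(** * The search procedures *)

Definition indicator (n : nat) (T : {set 'I_n}) : cube n :=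
  [ffun i => i \in T].

Definition prefix_set (n p : nat) : {set 'I_n} := [set i : 'I_n | (i < p)%N].

Definition all_ones (n : nat) (T : {set 'I_n}) : partial_assignment n :=
  existT _ T [ffun=> true].

(** [e] counts the remaining halvings, which suffice when [hi - lo < 2 ^ e]. Once [lo = hi] is the
    threshold, further queries change nothing. *)
Fixpoint binary_search (n : nat) (A : Type) (x : nat -> cube n)
    (cont : nat -> query_alg n A) (e lo hi : nat) : query_alg n A :=
  if e is e'.+1 then
    let mid := (lo + hi)./2 in
    Query (x mid) (fun b => if b then binary_search _ _ x cont e' lo mid
                            else binary_search _ _ x cont e' mid.+1 hi)
  else cont lo.

(** [m] is fuel for the additions to [T]. The new element enters as the set of [i] with
    [val i == j], which spares a proof of [j < n]. *)
Fixpoint minterm_search (n e m : nat) (T : {set 'I_n}) (p : nat) :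
    query_alg n (partial_assignment n) :=
  if m is m'.+1 then
    binary_search n _ (fun i => indicator n (T :|: prefix_set n i))
      (fun q => if q is j.+1 then
                  minterm_search n e m' (T :|: [set i : 'I_n | val i == j]) j
                else Return n (all_ones n T)) e 0 p
  else Return n (all_ones n T).

(** No query is affordable when [n = 1], since [ln 1 = 0], or when [k = 0]. *)
Definition certificate_search (n k : nat) : query_alg n (partial_assignment n) :=
  if (n <= 1)%N || (k == 0)%N then Return n (all_ones n set0)
  else Query (indicator n setT) (fun b =>
    if b then minterm_search n (trunc_log 2 n).+1 k.+1 set0 n
    else Return n (all_ones n set0)).

(** * Worst-case query counts *)

Lemma num_queries_binary_search n A (f : cube n -> bool) x
    (cont : nat -> query_alg n A) c e lo hi :
    (forall q, num_queries f (cont q) <= c)%N ->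
  (num_queries f (binary_search n A x cont e lo hi) <= e + c)%N.
Proof.
move=> cont_le; elim: e lo hi => [|e IHe] lo hi /=; first exact: cont_le.
by rewrite addSn ltnS; case: ifP => _; apply: IHe.
Qed.

Lemma num_queries_minterm_search n (f : cube n -> bool) e m T p :
  (num_queries f (minterm_search n e m T p) <= m * e)%N.
Proof.
elim: m T p => [|m IHm] T p //=; rewrite mulSn.
by apply: num_queries_binary_search => -[|j] //=.
Qed.

Lemma num_queries_certificate_search n k (f : cube n -> bool) :
  (num_queries f (certificate_search n k) <= 6 * k * trunc_log 2 n)%N.
Proof.
rewrite /certificate_search; case: ifPn => //.
rewrite negb_or -ltnNge -lt0n => /andP[n_gt1 k_gt0] /=.
have log_gt0 : (0 < trunc_log 2 n)%N by rewrite trunc_log_gt0.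
(* For positive factors each successor at most doubles, and the initial query adds one. *)
have le1 : ((k.+1 * (trunc_log 2 n).+1).+1 <= 6 * k * trunc_log 2 n)%N by nia.
apply: leq_trans le1; rewrite ltnS.
by case: ifP => _ //; exact: (num_queries_minterm_search n f (trunc_log 2 n).+1 k.+1).
Qed.

(** * Correctness of the search *)

Lemma output_prob_binary_search (R : realType) n A (f : cube n -> bool)
    (E : pred A) x (cont : nat -> query_alg n A) q e lo hi :
    (forall i, (i <= hi)%N -> f (x i) = (q <= i)%N) ->
    (lo <= q <= hi)%N -> (hi < lo + 2 ^ e)%N ->
  output_prob R f E (binary_search n A x cont e lo hi) =
  output_prob R f E (cont q).
Proof.
elim: e lo hi => [|e IHe] lo hi fq /andP[lo_q q_hi] hi_lt /=.
  by have -> : lo = q by move: hi_lt; rewrite expn0; lia.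
move: hi_lt; rewrite expnS => hi_lt.
rewrite fq; last by lia.
by case: leqP => mid_q; apply: IHe => [i i_le||]; rewrite ?fq //; lia.
Qed.

Lemma output_prob_Return_true (R : realType) n A (f : cube n -> bool)
  (E : pred A) a : E a -> output_prob R f E (Return n a) = 1.
Proof. by move=> /= ->. Qed.

Lemma monotone_indicator n (f : cube n -> bool) (A B : {set 'I_n}) :
  monotone_fun f -> A \subset B -> f (indicator n A) -> f (indicator n B).
Proof.
move=> fmon /subsetP AB; apply/implyP/fmon => i; rewrite !ffunE.
exact/implyP/AB.
Qed.

Lemma small_certificate n (f : cube n -> bool) x :
  exists2 S, certifies f x S & (#|S| <= certificate_complexity f)%N.
Proof.
set S := [arg min_(S < [set: 'I_n] | certifies f x S) #|S| ]%N.
exists S; last exact: (leq_bigmax x).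
rewrite /S; case: arg_minnP => //.
apply/forallP => y; apply/implyP => /forall_inP yx; apply/eqP; congr f.
by apply/ffunP => i; apply/esym/eqP/yx; rewrite inE.
Qed.

(** The indicators of [U] and [S :&: U] agree on [S]. *)
Lemma certified_subset n (f : cube n -> bool) (U S : {set 'I_n}) :
  certifies f (indicator n U) S -> f (indicator n U) -> f (indicator n (S :&: U)).
Proof.
move=> /forallP/(_ (indicator n (S :&: U))) /implyP H fU.
rewrite (eqP (H _)) //; apply/forall_inP => i iS.
by rewrite !ffunE inE iS.
Qed.

(** If a certificate [S] at [U] missed some [t] in [T], then [S :&: U] would lie in [U :\ t] and
    monotonicity would make [f] true there. *)
Lemma card_critical n (f : cube n -> bool) (T U : {set 'I_n}) :
    monotone_fun f -> f (indicator n U) ->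
    (forall t, t \in T -> ~~ f (indicator n (U :\ t))) ->
  (#|T| <= certificate_complexity f)%N.
Proof.
move=> fmon fU crit; have [S certS leS] := small_certificate n f (indicator n U).
apply: leq_trans leS; apply/subset_leq_card/subsetP => t tT.
apply: contraT => tS; apply: contraNT (crit t tT) => _.
apply: monotone_indicator (certified_subset _ _ _ _ certS fU) => //.
apply/subsetP => i; rewrite !inE => /andP[iS ->]; rewrite andbT.
by apply: contraNneq tS => <-.
Qed.

Lemma prefix_setS n j :
  prefix_set n j.+1 = [set i : 'I_n | val i == j] :|: prefix_set n j.
Proof. by apply/setP => i; rewrite !inE ltnS leq_eqVlt. Qed.

Lemma prefix_set_mono n i j :
  (i <= j)%N -> prefix_set n i \subset prefix_set n j.
Proof. by move=> ij; apply/subsetP => t; rewrite !inE => /leq_trans->. Qed.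

Lemma output_prob_minterm_search (R : realType) n (f : cube n -> bool)
    (E : pred (partial_assignment n)) e m T p :
    monotone_fun f -> (p < 2 ^ e)%N ->
    f (indicator n (T :|: prefix_set n p)) ->
    (forall t, t \in T -> ~~ f (indicator n ((T :|: prefix_set n p) :\ t))) ->
    (certificate_complexity f < #|T| + m)%N ->
    (forall S, f (indicator n S) -> (#|S| <= certificate_complexity f)%N ->
       E (all_ones n S)) ->
  output_prob R f E (minterm_search n e m T p) = 1.
Proof.
move=> fmon + + + + goodE; elim: m T p => [|m IHm] T p p_lt fT crit fuel.
  (* Fuel cannot run out: [T] would exceed the certificate complexity. *)
  by have := card_critical _ _ _ _ fmon fT crit; lia.
have [q fq q_min] := ex_minnP (ex_intro
  (fun i => f (indicator n (T :|: prefix_set n i))) p fT).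
have q_le_p : (q <= p)%N by exact: q_min.
have fE i : f (indicator n (T :|: prefix_set n i)) = (q <= i)%N.
  apply/idP/idP => [/q_min //|q_i].
  exact/(monotone_indicator _ _ _ _ fmon _ fq)/setUS/prefix_set_mono.
rewrite /= (output_prob_binary_search _ _ _ _ _ _ _ q) //.
case: q => [|j] in fq q_min q_le_p fE *.
  apply: output_prob_Return_true; apply: goodE; last first.
    exact: card_critical fmon fT crit.
  by apply: monotone_indicator fq => //; apply/subsetP=> i; rewrite !inE orbF.
have step : T :|: [set i : 'I_n | val i == j] :|: prefix_set n j =
    T :|: prefix_set n j.+1 by rewrite prefix_setS setUA.
apply: IHm; rewrite ?step //.
- exact: leq_ltn_trans (ltnW q_le_p) p_lt.
(* Old elements stay critical because the set only shrinks. *)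
- move=> t; rewrite inE => /orP[tT|].
    apply: contraNN (crit t tT); apply: monotone_indicator => //.
    exact/setSD/setUS/prefix_set_mono.
  (* Removing [j] leaves a subset of [T :|: prefix_set n j], where [f] is false since [j.+1] is the
     least threshold. *)
  rewrite inE => /eqP tj; apply: contraFN (ltnn j); rewrite -fE.
  apply: monotone_indicator => //; apply/subsetP => i; rewrite !inE.
  rewrite ltnS leq_eqVlt -tj => /andP[i_t /orP[->//|/orP[/eqP/val_inj it|->]]].
    by rewrite it eqxx in i_t.
  by rewrite orbT.
(* [T] grows strictly: otherwise [f] would already be true with prefix [j]. *)
- apply: leq_trans fuel _; rewrite addnS -addSn leq_add2r.
  apply: proper_card; rewrite properEneq subsetUl andbT.
  by apply: contraFneq (ltnn j) => TE; rewrite -fE [in X in X :|: _]TE step.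
Qed.

Lemma is_certificate_constant n (f : cube n -> bool) c :
  (forall y z, f y = f z) -> is_certificate f c.
Proof.
move=> fc; apply/forallP => y; apply/forallP => z.
by rewrite (fc y z) eqxx !implybT.
Qed.

Lemma is_certificate_all_ones n (f : cube n -> bool) (T : {set 'I_n}) :
  monotone_fun f -> f (indicator n T) -> is_certificate f (all_ones n T).
Proof.
move=> fmon fT.
have one y : restrict (n := n) T y == [ffun=> true] -> f y.
  move=> /eqP yT; apply: (implyP (fmon _ _ _) fT) => i; rewrite ffunE.
  apply/implyP => iT.
  by have /ffunP/(_ (exist _ i iT)) := yT; rewrite !ffunE /= => ->.
apply/forallP => y; apply/forallP => z.
by apply/implyP => /one ->; apply/implyP => /one ->.
Qed.

(** An empty certificate at one point fixes [f] everywhere. *)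
Lemma constant_of_certificate_complexity0 n (f : cube n -> bool) :
  certificate_complexity f = 0%N -> forall y z, f y = f z.
Proof.
move=> f0 y z; have [S /forallP/(_ y)] := small_certificate n f z.
rewrite f0 leqn0 cards_eq0 => + /eqP S0; rewrite S0 => /implyP H.
by apply/eqP/H/forall_inP => i; rewrite inE.
Qed.

Lemma output_prob_certificate_search (R : realType) n k (f : cube n -> bool)
    (E : pred (partial_assignment n)) :
    (1 < n)%N -> monotone_fun f -> (certificate_complexity f <= k)%N ->
    (forall c, is_certificate f c -> (#|tag c| <= k)%N -> E c) ->
  output_prob R f E (certificate_search n k) = 1.
Proof.
move=> n_gt1 fmon fk goodE; rewrite /certificate_search leqNgt n_gt1 /=.
have const_case : (forall y z, f y = f z) ->
    output_prob R f E (Return n (all_ones n set0)) = 1.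
  move=> fc; apply: output_prob_Return_true; apply: goodE.
    exact: is_certificate_constant.
  by rewrite /= cards0.
case: eqP => [k0|_] /=.
  apply/const_case/constant_of_certificate_complexity0.
  by move: fk; rewrite k0 leqn0 => /eqP.
case: ifPn => [f1|f1].
  have U : set0 :|: prefix_set n n = setT.
    by apply/setP => i; rewrite !inE ltn_ord.
  apply: (output_prob_minterm_search R n f E (trunc_log 2 n).+1 k.+1 set0 n); rewrite ?U // ?cards0 //.
  - by rewrite trunc_log_ltn.
  - by move=> t; rewrite inE.
  move=> S fS Sk; apply: goodE; first exact: is_certificate_all_ones.
  exact: leq_trans fk.
have f0 y : f y = false.
  apply: contraNF f1; apply/implyP/fmon => i.
  by rewrite ffunE inE implybT.
by apply: const_case => y z; rewrite !f0.
Qed.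

Lemma trunc_log2_le_ln (R : realType) n : (0 < n)%N ->
  (trunc_log 2 n)%:R * ln 2 <= ln (n%:R : R).
Proof.
move=> n_gt0; rewrite mulr_natl -lnXn ?ltr0n // ler_ln ?posrE ?exprn_gt0 ?ltr0n //.
by rewrite -natrX ler_nat trunc_logP.
Qed.

Theorem theorem5 (R : realType) (d : nat) :
  exists (alg : forall n : nat, nat -> query_alg n (partial_assignment n))
         (Cq Cs : R),
  forall (n k : nat) (f : cube n -> bool),
    (0 < n)%N ->
    monotone_fun f ->
    (certificate_complexity f <= k)%N ->
    (num_queries f (alg n k))%:R <= Cq * k%:R ^+ 7 * ln (n%:R : R) /\
    1 - n%:R ^- d <=
      output_prob R f
        (fun c => is_certificate f c && (#|tag c|%:R <= Cs * k%:R ^+ 3))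
        (alg n k).
Proof.
have ln2_gt0 : 0 < ln (2 : R) by rewrite ln_gt0 // ltr1n.
(* The factor [1 / ln 2] changes the base of the logarithm. The certificate has at most [k]
   elements, and [k <= k ^ 3]. *)
exists certificate_search, (6 / ln 2), 1 => n k f n_gt0 fmon fk.
have le_pow m : (k%:R : R) <= k%:R ^+ m.+1.
  by rewrite -natrX ler_nat; case: (k) => // k'; rewrite -[leqLHS]expn1 leq_pexp2l.
split.
  apply: (@le_trans _ _ ((6 * k * trunc_log 2 n)%:R)).
    by rewrite ler_nat num_queries_certificate_search.
  move: (k%:R ^+ 7) (le_pow 6) => K le_K.
  rewrite !natrM -!mulrA ler_wpM2l // mulrCA ler_pM //.
  by rewrite mulrC ler_pdivlMr // trunc_log2_le_ln.
have [n_gt1|n_le1] := ltnP 1 n.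
  rewrite output_prob_certificate_search // => [|c -> ck].
    by rewrite gerBl invr_ge0 exprn_ge0.
  by rewrite mul1r (le_trans _ (le_pow 2)) // ler_nat.
(* For [n = 1] the required probability is [1 - 1 = 0]. *)
have -> : n%:R = 1 :> R by rewrite (_ : n = 1%N) //; lia.
by rewrite expr1n invr1 subrr /certificate_search n_le1 /= ler0n.
Qed.
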